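(* For all integers $t\geq 4$ and $s\geq 3$, $\mathrm{oh}(K_t\times K_s)\geq t\lfloor s/3\rfloor$.
   Context: $\mathrm{oh}(G)$ (Odd Hadwiger number) of a finite simple graph $G$ is the largest integer $m$ for which there exist $m$ pairwise vertex-disjoint trees $Z_1,\dots,Z_m$ in $G$ and a 2-colouring $c$ of $V(Z_1)\cup\dots\cup V(Z_m)$ that is proper on each $Z_k$, such that for every $k\neq k'$ there is an edge $xy\in E(G)$ with $x\in V(Z_k)$, $y\in V(Z_{k'})$, $c(x)=c(y)$. The direct product $G\times H$ has vertex set $V(G)\times V(H)$, with $(v_1,u_1)\sim(v_2,u_2)$ iff $v_1v_2\in E(G)$ and $u_1u_2\in E(H)$. *)

(* Defs.v *)
From mathcomp Require Import all_boot.
From mathcomp Require Import boolp.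

Set Implicit Arguments.
Unset Strict Implicit.
Unset Printing Implicit Defensive.

Record sgraph := SGraph {
  vertex :> finType;
  adj : rel vertex;
  adj_sym : symmetric adj;
  adj_irr : irreflexive adj }.

Definition complete_rel (n : nat) : rel 'I_n := fun x y => x != y.

Lemma complete_sym n : symmetric (@complete_rel n).
Proof. by move=> x y; rewrite /complete_rel eq_sym. Qed.

Lemma complete_irr n : irreflexive (@complete_rel n).
Proof. by move=> x; rewrite /complete_rel eqxx. Qed.

Definition complete_graph (n : nat) : sgraph :=
  SGraph (@complete_sym n) (@complete_irr n).

Definition direct_rel (G H : sgraph) : rel (G * H)%type :=
  fun p q => adj p.1 q.1 && adj p.2 q.2.

Lemma direct_sym G H : symmetric (@direct_rel G H).
Proof. by move=> p q; rewrite /direct_rel adj_sym [adj p.2 _]adj_sym. Qed.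

Lemma direct_irr G H : irreflexive (@direct_rel G H).
Proof. by move=> p; rewrite /direct_rel adj_irr. Qed.

Definition direct_product (G H : sgraph) : sgraph :=
  SGraph (@direct_sym G H) (@direct_irr G H).

(* A subgraph need not be induced. *)
Record subgraph (G : sgraph) := Subgraph {
  sub_verts : {set G};
  sub_adj : rel G;
  sub_adj_sym : symmetric sub_adj;
  sub_adj_adj : forall x y, sub_adj x y -> adj x y;
  sub_adj_verts : forall x y,
    sub_adj x y -> (x \in sub_verts) && (y \in sub_verts) }.

Definition sub_connected (G : sgraph) (Z : subgraph G) : Prop :=
  sub_verts Z != set0 /\
  {in sub_verts Z &, forall x y, connect (sub_adj Z) x y}.

(* [ucycle] counts [:: x; y] as a cycle as soon as x and y are adjacent, so the
   cycles of graph theory are those with at least three vertices. *)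
Definition sub_acyclic (G : sgraph) (Z : subgraph G) : Prop :=
  forall p : seq G, ucycle (sub_adj Z) p -> size p < 3.

Definition is_tree (G : sgraph) (Z : subgraph G) : Prop :=
  sub_connected Z /\ sub_acyclic Z.

(* The colouring is total; its values outside the trees are irrelevant. *)
Definition odd_clique_model (G : sgraph) (m : nat)
    (Z : 'I_m -> subgraph G) (c : G -> bool) : Prop :=
  [/\ forall k, is_tree (Z k),
      forall k k', k != k' -> [disjoint sub_verts (Z k) & sub_verts (Z k')],
      forall k x y, sub_adj (Z k) x y -> c x != c y
    & forall k k', k != k' ->
        exists x y, [/\ x \in sub_verts (Z k), y \in sub_verts (Z k'),
                        adj x y & c x = c y]].

Definition has_odd_clique_model (G : sgraph) (m : nat) : Prop :=
  exists (Z : 'I_m -> subgraph G) (c : G -> bool), odd_clique_model Z c.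

(* Bounding m by #|G| loses nothing: see [oh_max]. *)
Definition oh (G : sgraph) : nat :=
  \max_(m < #|G|.+1 | `[< has_odd_clique_model G m >]) m.

Lemma has_odd_clique_model0 (G : sgraph) : has_odd_clique_model G 0.
Proof.
have z (P : 'I_0 -> Type) k : P k by case: k.
by exists (fun k => z _ k), (fun _ => true); split; apply: z.
Qed.

Lemma odd_clique_model_card (G : sgraph) (m : nat) :
  has_odd_clique_model G m -> m <= #|G|.
Proof.
case=> Z [c [tZ dZ _ _]].
have exZ k : exists x, x \in sub_verts (Z k).
  by have [[/set0Pn nZ _] _] := tZ k.
pose f k := xchoose (exZ k).
have f_inj : injective f.
  move=> k k' Ef; apply/eqP/contraT => /dZ/disjointFr/(_ (xchooseP (exZ k))).
  by rewrite -/(f k) Ef (xchooseP (exZ k')).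
by rewrite -[m]card_ord -(card_codom f_inj) max_card.
Qed.

Lemma oh_model (G : sgraph) : has_odd_clique_model G (oh G).
Proof.
pose P (m : 'I_#|G|.+1) := `[< has_odd_clique_model G m >].
have P0 : P ord0 by apply/asboolP; apply: has_odd_clique_model0.
rewrite /oh (bigmax_eq_arg _ P0).
by case: arg_maxnP => // m /asboolP.
Qed.

Lemma oh_max (G : sgraph) (m : nat) : has_odd_clique_model G m -> m <= oh G.
Proof.
move=> Gm; have lt_m : m < #|G|.+1 by rewrite ltnS odd_clique_model_card.
by apply: (leq_bigmax_cond (Ordinal lt_m)); apply/asboolP.
Qed.

(* Main.v *)
Require Import Defs.
From mathcomp Require Import all_boot.
From mathcomp Require Import zify.

(** Cut the columns of [K_t x K_s] into [s %/ 3] blocks of three. For a row [i]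
    and a block with columns [a], [b], [d], take the path
    [(i, a) - (i + 2, d) - (i + 1, b)], rows being read modulo [t], and colour
    the third column of every block differently from the two others. Any
    two paths, from rows [i] and [i'] and blocks with columns [a], [b], [d] and
    [a'], [b'], [d'], are joined by [(i, a) (i' + 1, b')] or by
    [(i', a') (i + 1, b)]: both fail only if [i = i' + 1] and [i' = i + 1],
    which is impossible modulo [t >= 3]. *)

Section Star.
Variables (G : sgraph) (y : G) (A : {set G}).
Hypothesis adj_yA : forall x, x \in A -> adj y x.

(** Edges of [G] inside [A] are left out, so the star is a tree even if [A] is not independent; the
    two ends of a path below are in fact adjacent. *)
Definition star_rel : rel G :=
  fun u v => (u == y) && (v \in A) || (v == y) && (u \in A).

Lemma star_rel_sym : symmetric star_rel.
Proof. by move=> u v; rewrite /star_rel orbC. Qed.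

Lemma star_rel_adj u v : star_rel u v -> adj u v.
Proof.
by case/orP=> /andP[/eqP-> /adj_yA]; rewrite // adj_sym.
Qed.

Lemma star_rel_verts u v : star_rel u v -> (u \in y |: A) && (v \in y |: A).
Proof. by case/orP=> /andP[/eqP-> vA]; rewrite !inE eqxx vA ?orbT. Qed.

Definition star : subgraph G :=
  Subgraph star_rel_sym star_rel_adj star_rel_verts.

Lemma star_is_tree : is_tree star.
Proof.
split; first split.
- by apply/set0Pn; exists y; rewrite setU11.
- have conn_y x : x \in y |: A -> connect star_rel y x.
    case/setU1P=> [-> // | xA]; apply: connect1.
    by rewrite /star_rel eqxx xA.
  move=> u v /conn_y yu /conn_y yv; apply: connect_trans yv.
  by rewrite (sym_connect_sym star_rel_sym).
(* All edges of a cycle [u0, u1, u2, ...] contain [y]: so do [u0 u1] and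
   [u1 u2], which forces [y = u1], and then the edge closing the cycle does
   not. *)
- have star_y u v : star_rel u v -> (u == y) || (v == y).
    by case/orP=> /andP[-> _]; rewrite ?orbT.
  case=> [|u0 [|u1 [|u2 p]]] //; rewrite /ucycle /=.
  rewrite rcons_path => /andP[/and4P[/star_y e01 /star_y e12 _ /star_y ep0]].
  case/and3P=> u0p u1p _.
  move: (mem_last u2 p) ep0 e01 e12; set w := last u2 p => wp.
  have n01: u0 != u1 by apply: contraNneq u0p => ->; rewrite mem_head.
  have n02: u0 != u2 by apply: contraNneq u0p => ->; rewrite !inE eqxx orbT.
  have nw1: w != u1 by apply: contraNneq u1p => <-.
  have [<-|_] := eqVneq u1 y; first by rewrite (negPf n01) (negPf nw1).
  by rewrite orbF => _ /eqP e0; rewrite orFb -e0 eq_sym (negPf n02).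
Qed.

End Star.

(** Renumbering by [enum_val] lets the trees be indexed directly by pairs of a row and a block. *)
Lemma card_le_oh (G : sgraph) (K : finType) (Z : K -> subgraph G)
    (c : G -> bool) :
  (forall k, is_tree (Z k)) ->
  (forall k k', k != k' -> [disjoint sub_verts (Z k) & sub_verts (Z k')]) ->
  (forall k x y, sub_adj (Z k) x y -> c x != c y) ->
  (forall k k', k != k' ->
     exists x y, [/\ x \in sub_verts (Z k), y \in sub_verts (Z k'),
                     adj x y & c x = c y]) ->
  #|K| <= oh G.
Proof.
move=> tZ dZ cZ eZ; apply: oh_max.
exists (fun k => Z (enum_val k)), c.
split=> [k|k k' nk|k|k k' nk]; first exact: tZ.
- by apply: dZ; rewrite (inj_eq enum_val_inj).
- exact: cZ.
- by apply: eZ; rewrite (inj_eq enum_val_inj).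
Qed.

Lemma val_ordS t (i : 'I_t) : ordS i = (if i.+1 == t then 0 else i.+1) :> nat.
Proof.
rewrite /=; case: eqP => [->|/eqP ni]; first exact: modnn.
by rewrite modn_small // ltn_neqAle ni ltn_ord.
Qed.

Lemma ordS_neq t (i : 'I_t) : 1 < t -> ordS i != i.
Proof.
move=> t1; apply/eqP=> /(congr1 (@nat_of_ord t)); rewrite val_ordS.
by case: eqP; lia.
Qed.

Lemma ordS2_neq t (i : 'I_t) : 2 < t -> ordS (ordS i) != i.
Proof.
move=> t2; apply/eqP=> /(congr1 (@nat_of_ord t)); rewrite !val_ordS.
by do 2 case: eqP; lia.
Qed.

Lemma block_col_lt s (j : 'I_(s %/ 3)) (r : 'I_3) : 3 * j + r < s.
Proof. by have := ltn_ord j; have := ltn_ord r; lia. Qed.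

Definition block_col s (j : 'I_(s %/ 3)) (r : 'I_3) : 'I_s :=
  Ordinal (block_col_lt s j r).

Lemma block_col_eq s (j j' : 'I_(s %/ 3)) (r r' : 'I_3) :
  (block_col s j r == block_col s j' r') = (j == j') && (r == r').
Proof.
by rewrite -!val_eqE /=; have := ltn_ord r; have := ltn_ord r'; lia.
Qed.

Section Model.
Variables t s : nat.
Hypothesis t_gt2 : 2 < t.

Let G := direct_product (complete_graph t) (complete_graph s).
Let K : finType := ('I_t * 'I_(s %/ 3))%type.

(** [r] is both the row shift and the position in the block; the middle of the path is [r = 2]. *)
Definition path_vertex (k : K) (r : 'I_3) : G :=
  (iter r (@ordS t) k.1, block_col s k.2 r).

Let r0 : 'I_3 := @Ordinal 3 0 isT.
Let r1 : 'I_3 := @Ordinal 3 1 isT.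
Let r2 : 'I_3 := @Ordinal 3 2 isT.

(** The column determines the block and [r]; undoing [r] injective row shifts then recovers the
    row. *)
Lemma path_vertex_inj k k' r r' :
  path_vertex k r = path_vertex k' r' -> k = k'.
Proof.
case: k k' => [i j] [i' j'] /eqP.
rewrite xpair_eqE block_col_eq => /and3P[/= Ei /eqP-> /eqP Er].
move: Ei; rewrite Er; elim: {r Er}(r' : nat) => [|n IHn] /=; first by move/eqP->.
by rewrite (inj_eq (@ordS_inj t)).
Qed.

Lemma adj_path_vertex k k' r r' : adj (path_vertex k r) (path_vertex k' r') =
  (iter r (@ordS t) k.1 != iter r' (@ordS t) k'.1) &&
  ((k.2 != k'.2) || (r != r')).
Proof.
by rewrite /= /direct_rel /= /complete_rel block_col_eq negb_and.
Qed.

(** Blocks start at multiples of 3, so the residue of the column is the position [r]. *)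
Definition path_color (x : G) : bool := x.2 %% 3 == 2.

Lemma path_color_vertex k r : path_color (path_vertex k r) = (r == r2).
Proof. by rewrite /path_color -val_eqE /=; have := ltn_ord r; lia. Qed.

Definition path_ends (k : K) : {set G} :=
  [set path_vertex k r0; path_vertex k r1].

Lemma adj_path_ends k x : x \in path_ends k -> adj (path_vertex k r2) x.
Proof.
case/set2P=> ->; rewrite adj_path_vertex orbT andbT /=.
  exact: ordS2_neq.
by rewrite ordS_neq // ltnW.
Qed.

Definition path_tree (k : K) : subgraph G := star G _ _ (adj_path_ends k).

Lemma path_tree_vertsP k x :
  x \in sub_verts (path_tree k) -> exists r, x = path_vertex k r.
Proof. by case/setU1P=> [->|/set2P[]->]; [exists r2|exists r0|exists r1]. Qed.

Lemma path_end_color k x : x \in path_ends k -> path_color x = false.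
Proof. by case/set2P=> ->; rewrite path_color_vertex. Qed.

(** An [r0] end and an [r1] end lie in distinct columns, even within one block, so only their rows
    need comparing. *)
Lemma path_trees_joined k k' :
  exists x y, [/\ x \in path_ends k, y \in path_ends k' & adj x y].
Proof.
case: k k' => [i j] [i' j'].
have in0 l : path_vertex l r0 \in path_ends l by rewrite !inE eqxx.
have in1 l : path_vertex l r1 \in path_ends l by rewrite !inE eqxx orbT.
(* If [i = i' + 1], the other pair has rows [i + 1 = i' + 2] and [i'], distinct as [t > 2]. *)
have [Ei|ni] := eqVneq i (ordS i').
  exists (path_vertex (i, j) r1), (path_vertex (i', j') r0).
  by split; rewrite // adj_path_vertex orbT andbT /= Ei ordS2_neq.
by exists (path_vertex (i, j) r0), (path_vertex (i', j') r1);
  split; rewrite // adj_path_vertex orbT andbT.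
Qed.

Lemma leq_oh_direct_complete : t * (s %/ 3) <= oh G.
Proof.
have -> : t * (s %/ 3) = #|K| by rewrite card_prod !card_ord.
apply: (@card_le_oh _ _ path_tree path_color) => [k|k k' nk|k x y|k k' nk].
- exact: star_is_tree.
- apply/pred0Pn => -[x /andP[/path_tree_vertsP[r ->] /path_tree_vertsP[r']]].
  by move/path_vertex_inj=> Ek; rewrite Ek eqxx in nk.
- by case/orP=> /andP[/eqP-> /path_end_color->]; rewrite path_color_vertex.
- have [x [y [xk yk' xy]]] := path_trees_joined k k'.
  exists x, y; split=> //; try by rewrite inE ?xk ?yk' orbT.
  by rewrite (path_end_color _ _ xk) (path_end_color _ _ yk').
Qed.

End Model.

Theorem theorem12 (t s : nat) (ht : 4 <= t) (hs : 3 <= s) :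
  t * (s %/ 3) <= oh (direct_product (complete_graph t) (complete_graph s)).
Proof. exact: leq_oh_direct_complete (ltnW ht). Qed.
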